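(* Let $k_0>0$, let $g_{\mathrm{ini}}\in C([0,1];\mathbb{R}^+)$ satisfy $\int_0^1 x\,g_{\mathrm{ini}}(x)\,dx=1$, let $g$ be the global mild solution (defined in the context) of $$\frac{\partial g}{\partial t}(t,x)=-\frac{k_0}{N(t)}g(t,x)g(t,t-x),\qquad N(t)=\int_0^t g(t,x)\,dx,\qquad \int_0^t x\,g(t,x)\,dx=1\qquad(t\ge1,\ 0\le x\le t)$$ with initial data $g(1,\cdot)=g_{\mathrm{ini}}$, and let $N(t)=\int_0^t g(t,x)\,dx$. (i) If there exists $c_0>0$ such that $N(t)\ge c_0$ for all $t\ge1$, then for every $x\ge 0$ the limit $g_\infty(x):=\lim_{t\to\infty}g(t,x)$ exists and satisfies $g_\infty(x)>0$. (ii) If $k_0<1/3$, then $N(t)>N(1)/2$ for all $t\ge1$.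
   Context: Here $\mathbb{R}^+=(0,\infty)$. The global mild solution is the function $g:[1,\infty)\times[0,\infty)\to[0,\infty)$ whose restriction to $[1,T]\times[0,T]$ is, for every $T>1$, the unique mild solution on $[1,T]$ with initial data $g_{\mathrm{ini}}$, and with $g(t,x)=0$ for $x>t$. The existence and uniqueness of this solution for every $T>1$ may be taken as known. A mild solution on $[1,T]$ is a function $g:[1,T]\times[0,T]\to[0,\infty)$ with $g(1,x)=g_{\mathrm{ini}}(x)$ for $x\in[0,1)$, with $g(t,x)=0$ for $x>t$, continuous at all points $(t,x)$ with $x\ne1$ and $x\neq t$, with $0<N(t)<\infty$ and $B[g](t)<\infty$ for all $t\in[1,T]$, and such that $$g(t,x)=\begin{cases} g_{\mathrm{ini}}(x)\exp\left(-k_0\int_1^t\frac{g(s,s-x)}{N(s)}\,ds\right), & x<1,\\[4pt] B[g](x)\exp\left(-k_0\int_x^t\frac{g(s,s-x)}{N(s)}\,ds\right), & 1\le x\le t,\end{cases}$$ where $N(t)=\int_0^t g(t,x)\,dx$ and $B[g](t)=\frac{k_0}{2N(t)}\int_0^t g(t,x)\,g(t,t-x)\,dx$. Mild solutions satisfy the mass constraint $\int_0^t x\,g(t,x)\,dx=1$ for all $t$. *)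

(* Defs.v *)
(* MathComp-Analysis; real numbers are an arbitrary [R : realType], integrals are
   Lebesgue integrals with values in [\bar R]. *)
From HB Require Import structures.
From mathcomp Require Export all_boot all_order all_algebra.
From mathcomp Require Export all_classical all_reals all_analysis.

Set Implicit Arguments.
Unset Strict Implicit.
Unset Printing Implicit Defensive.

Import Order.TTheory GRing.Theory Num.Theory.
Import numFieldNormedType.Exports.

Local Open Scope classical_set_scope.
Local Open Scope ring_scope.

Definition total_number {R : realType} (g : R -> R -> R) (t : R) : \bar R :=
  (\int[@lebesgue_measure R]_(x in `[0%R, t]) (g t x)%:E)%E.

Definition birth {R : realType} (k0 : R) (g : R -> R -> R) (t : R) : \bar R :=
  (k0%:E / (2%:E * total_number g t) *
   \int[@lebesgue_measure R]_(x in `[0%R, t]) (g t x * g t (t - x))%:E)%E.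

(* exp (- k0 \int_a^t g(s, s - x) / N(s) ds). The integral is extended-real
   valued: its finiteness is not assumed, and the factor is 0 if it diverges. *)
Definition survival {R : realType} (k0 : R) (g : R -> R -> R) (a t x : R) :
    \bar R :=
  expeR (- (k0%:E * \int[@lebesgue_measure R]_(s in `[a, t])
                      ((g s (s - x))%:E / total_number g s)))%E.

(* [g] is a total function, but only its values on [1, T] x [0, T] matter: all
   integrals below only involve such values, and continuity is relative to that
   rectangle. The mass constraint \int_0^t x g(t, x) dx = 1 is not a clause: it
   follows from the others when \int_0^1 x gini(x) dx = 1. *)
Definition mild_solution {R : realType} (k0 : R) (gini : R -> R) (T : R)
    (g : R -> R -> R) : Prop :=
  let dom := `[1, T]%classic `*` `[0, T]%classic : set (R * R) in
  [/\ forall t x, dom (t, x) -> 0 <= g t x,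
      forall x : R, 0 <= x < 1 -> g 1 x = gini x,
      forall t x, dom (t, x) -> t < x -> g t x = 0,
      forall t x, dom (t, x) -> x != 1 -> x != t ->
        g p.1 p.2 @[p --> within dom (nbhs (t, x))] --> g t x &
      forall t : R, 1 <= t <= T ->
        [/\ (0 < total_number g t < +oo)%E,
            (birth k0 g t < +oo)%E,
            forall x : R, 0 <= x < 1 ->
              (g t x)%:E = ((gini x)%:E * survival k0 g 1 t x)%E &
            forall x : R, 1 <= x <= t ->
              (g t x)%:E = (birth k0 g x * survival k0 g x t x)%E]].

Definition global_mild_solution {R : realType} (k0 : R) (gini : R -> R)
    (g : R -> R -> R) : Prop :=
  (forall T, 1 < T -> mild_solution k0 gini T g) /\
  (forall t x, 1 <= t -> t < x -> g t x = 0).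

(* Main.v *)
Require Import Defs.
From HB Require Import structures.
From mathcomp Require Import all_boot all_order all_algebra.
From mathcomp Require Import all_classical all_reals all_analysis.
From mathcomp Require Import measurable_realfun ring lra.
Import Order.TTheory GRing.Theory Num.Theory.
Import numFieldNormedType.Exports.
Local Open Scope classical_set_scope.
Local Open Scope ring_scope.

Set Implicit Arguments.
Unset Strict Implicit.
Unset Printing Implicit Defensive.

(** A particle of size x >= 1 can only be created at time x, when two particles
    whose sizes add up to x merge. Let G be the density of particles at their
    creation: gini on [0, 1), and the birth rate B(x) = B[g](x) for x >= 1. The
    mild formula reads g(t, x) = G(x) exp(- L(t, x)), where L is the loss
    accumulated by size x up to time t, so that g <= G. Everything rests on the
    balance [number_balance]
      N(1) - N(t) = \int_1^t B(s) ds,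
    which says that each merger destroys two particles and creates one.

    The balance is proved without differentiating N. For fixed x the exponential
    formula gives G(x) - g(t, x) as the integral in time of the loss term
    k0 g(s, x) g(s, s - x) / N(s) ([birth_profile_loss]); integrating in x, the
    theorem of Tonelli turns the total loss into twice the integral of B
    ([integral_total_loss]). Cancelling one copy of that integral requires it to
    be finite. It is, because of two merging particles of total size s one has
    size at most s / 2, so that doubling the range of sizes multiplies the bound
    on G by at most max(1, k0) ([birth_profile_locally_bounded]). The losses are finite
    since N is continuous and positive, hence bounded below on compact intervals
    ([number_lower_bound]).

    (i) If N >= c0, then g(s, s - x) <= G(s - x) and the balance bound L(t, x) by
    (k0 / c0) \int G <= 2 k0 N(1) / c0, uniformly in t ([cumulated_loss_le]). As
    L is nondecreasing in t, g(t, x) converges to a positive multiple of G(x).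
    Finally G > 0, by induction on unit intervals: for t in [n, n + 1) there is an
    interval of sizes x < 1 whose complements t - x are < n, and both densities
    are positive there ([birth_profile_gt0]).

    (ii) The integral of B N over [1, t] is (N(1)^2 - N(t)^2) / 2, because B is
    the rate of decrease of N ([integral_birth_number]). It is also at most
    (k0 / 2) (\int_0^t G)^2 = (k0 / 2) (2 N(1) - N(t))^2, since B N is k0 / 2 times
    the self-convolution of g(s, .) at s, and g <= G ([integral_birth_number_le]).
    At a time where N = N(1) / 2 the two estimates give 3 / 8 <= 9 k0 / 8, after
    division by N(1)^2. So no such time exists when k0 < 1 / 3, and by continuity
    N stays above N(1) / 2.

    The solution may jump across the lines x = 1 and x = t, and is governed by a
    formula at each single point. The analysis is therefore done on its
    regular part u, equal to g where 0 < x < t and x <> 1 and to 0 elsewhere: it is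
    jointly measurable, and differs from g by null sets in each of the integrals
    that define N, B and, for x > 0, the losses. *)

(** * Lebesgue integrals on the real line *)

Section lebesgue_integral_on_the_line.
Context {R : realType}.
Local Notation mu := (@lebesgue_measure R).

(** The points of [D] where [f > y] lie in a rational box on whose trace in [D]
    [f > y] holds throughout, and there are countably many such boxes. *)
Lemma within_continuous_measurable_prod (D : set (R * R)) (f : R * R -> R) :
  measurable D -> (forall p, D p -> f q @[q --> within D (nbhs p)] --> f p) ->
  measurable_fun D f.
Proof.
move=> mD cf; apply: (measurability _ (RGenOInfty.measurableE R)).
move=> _ [_ [y ->] <-].
pose box (q : rat * rat * rat) : set (R * R) :=
  ball (ratr q.1.1 : R) (ratr q.2) `*` ball (ratr q.1.2 : R) (ratr q.2).
pose good q := D `&` box q `<=` [set p | y < f p].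
pose F q := if pselect (good q) then box q else set0.
rewrite (_ : _ `&` _ = D `&` \bigcup_q F q).
  apply: measurableI => //.
  have cT : countable [set: rat * rat * rat] by apply: countableP.
  apply: (countable_bigcupT_measurable cT) => q; rewrite /F; case: pselect => /= // _.
  by apply: measurableX; exact: measurable_ball.
apply/seteqP; split=> [[p1 p2] [Dp]|p [Dp [q _]]]; last first.
  rewrite /F; case: pselect => /= // gq qp; split => //=; rewrite in_itv/= andbT.
  exact: gq.
rewrite /= in_itv/= andbT => yfp; split => //.
have : nbhs (p1, p2) [set q | D q -> y < f q].
  have := cf _ Dp; move/(_ `]y, +oo[%classic) => h.
  have : nbhs (f (p1, p2)) `]y, +oo[%classic.
    by apply: open_nbhs_nbhs; split; [exact: interval_open|rewrite /= in_itv/= yfp].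
  move/h; rewrite /= /nbhs/= /within/=.
  by apply: filterS => q /[apply]; rewrite /= in_itv/= andbT.
move/nbhs_ballP => [e /= e0 be].
(* A center within r and a radius r < e / 2 keep the box inside the e-ball. *)
have e2 : 0 < e / 2 by lra.
have [r] := rat_in_itvoo e2; rewrite in_itv/= => /andP[r0 re].
have near_rat (x : R) : exists q : rat, ball (ratr q : R) (ratr r) x.
  have xr : x < x + ratr r by rewrite ltrDl.
  have [q] := rat_in_itvoo xr; rewrite in_itv/= => /andP[xq qr].
  by exists q; rewrite /ball/= ltr_norml; lra.
have [q1 q1p] := near_rat p1; have [q2 q2p] := near_rat p2.
exists (q1, q2, r) => //; rewrite /F; case: pselect => /= //; apply.
move=> [z1 z2] [Dz [/= z1q z2q]].
apply: be => //; split => /=.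
- move: q1p z1q; rewrite /ball/= !ltr_norml; lra.
- move: q2p z2q; rewrite /ball/= !ltr_norml; lra.
Qed.

Lemma ge0_integral_reflect (f : R -> \bar R) (c : R) :
  measurable_fun setT f -> (forall x, 0 <= f x)%E ->
  (\int[mu]_x f (c - x)%R = \int[mu]_x f x)%E.
Proof.
move=> mf f0; pose phi (x : measurableTypeR R) : measurableTypeR R := c - x.
have mphi : measurable_fun setT phi.
  by have : measurable_fun setT (fun x : R => c - x) by apply: measurable_funB.
transitivity (\int[pushforward mu phi]_(x in setT) f x)%E.
  have H := @ge0_integral_pushforward _ _ _ _ R phi mphi mu setT f measurableT mf.
  by apply/esym/H => y _; exact: f0.
apply: eq_measure_integral => //= A mA _; apply/esym.
apply: lebesgue_measure_unique => //= _ [[a b]] _ <-.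
rewrite /pushforward (_ : phi @^-1` _ = `[c - b, c - a[%classic); last first.
  by apply/seteqP; split => x /=; rewrite !in_itv/= /phi; lra.
rewrite !lebesgue_measure_itv/= !lte_fin.
rewrite ltrD2l ltrN2; case: ifPn => // _; congr (_%:E); ring.
Qed.

Lemma ge0_integral_shift (f : R -> \bar R) (c : R) :
  measurable_fun setT f -> (forall x, 0 <= f x)%E ->
  (\int[mu]_x f (x - c)%R = \int[mu]_x f x)%E.
Proof.
move=> mf f0; have mfN : measurable_fun setT (fun x : R => f (- x)).
  by apply: measurableT_comp => //; exact: oppr_measurable.
transitivity (\int[mu]_x f (- x)%R)%E.
  rewrite -(@ge0_integral_reflect (fun x : R => f (- x)) c)//.
  by apply: eq_integral => x _; rewrite opprB.
rewrite -[RHS](@ge0_integral_reflect f 0)//.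
by apply: eq_integral => x _; rewrite sub0r.
Qed.

(** Measurability of [f2] is part of the conclusion, so that a solution known to
    be regular only off finitely many points can be integrated. *)
Lemma eq_integral_off_seq (s : seq R) (D : set R) (f1 f2 : R -> \bar R) :
  measurable D -> measurable_fun D f1 ->
  (forall x, D x -> x \notin s -> f1 x = f2 x) ->
  measurable_fun D f2 /\ (\int[mu]_(x in D) f1 x = \int[mu]_(x in D) f2 x)%E.
Proof.
move=> mD; elim: s f1 f2 => [|p s ih] f1 f2 mf1 f12.
  split; last by apply: eq_integral => x /set_mem Dx; exact: f12.
  by apply: eq_measurable_fun mf1 => x /set_mem Dx; exact: f12.
pose f3 x := if x == p then f2 x else f1 x.
have mDp : measurable (D `\ p) by apply: measurableD.
have mf3 : measurable_fun D f3.
  rewrite /f3; apply: (@measurable_funS _ _ _ _ ((D `\ p) `|` [set p])) => //.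
    exact: measurableU.
    by move=> x Dx; have [->|/eqP] := eqVneq x p; [right|left; split].
  apply/measurable_funU => //; split; last exact: measurable_fun_set1.
  apply: eq_measurable_fun (measurable_funS mD (@subDsetl _ _ _) mf1) => x.
  by rewrite inE => -[_ /eqP/negPf ->].
have [mf2 <-] : measurable_fun D f2 /\
    (\int[mu]_(x in D) f3 x = \int[mu]_(x in D) f2 x)%E.
  apply: ih => // x Dx xs; rewrite /f3; case: ifPn => // xp.
  by apply: f12; rewrite // inE negb_or xp.
split => //; rewrite -(@integral_setD1 _ f1 p)// -1?(@integral_setD1 _ f3 p)//.
- by apply: eq_integral => x; rewrite inE => -[_ /eqP/negPf]; rewrite /f3 => ->.
- exact: measurable_funS mf3.
- exact: measurable_funS mf1.
Qed.

(** The integral of a nonnegative function is a supremum over simple functions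
    below it, hence monotone for arbitrary functions. This serves at size x = 0,
    where the integrand of the loss lives on the line of discontinuity x = t. *)
Lemma ge0_le_integral_nomeas (A B : set R) (f1 f2 : R -> \bar R) :
  (forall x, A x -> 0 <= f1 x)%E -> (forall x, B x -> 0 <= f2 x)%E ->
  A `<=` B -> (forall x, A x -> f1 x <= f2 x)%E ->
  (\int[mu]_(x in A) f1 x <= \int[mu]_(x in B) f2 x)%E.
Proof.
move=> f10 f20 AB f12.
rewrite !ge0_integralE//.
apply: le_ereal_sup => _ [h hf <-]; exists h => // x; apply: le_trans (hf x) _.
rewrite /patch; case: ifPn => xA; case: ifPn => xB //.
- exact/f12/set_mem.
- by move: xB; rewrite notin_setE => /(_ (AB _ (set_mem xA))).
- exact/f20/set_mem.
Qed.

(** Cutting [a, b] into n pieces bounds the total increment by a multiple of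
    1 / n. *)
Lemma quadratic_increments_cst (Q : R -> R) (a b C : R) : a <= b ->
  (forall s s', a <= s -> s <= s' -> s' <= b -> `|Q s' - Q s| <= C * (s' - s) ^+ 2) ->
  Q b = Q a.
Proof.
move=> ab Qinc; apply/eqP; rewrite -subr_eq0 -normr_le0.
apply/ler_addgt0Pl => e e0; rewrite addr0.
set A := C * (b - a) ^+ 2.
have [n An] : exists n : nat, A / e < n.+1%:R.
  exists (Num.truncn (A / e)); exact: truncnS_gt.
pose h := (b - a) / n.+1%:R.
have h0 : 0 <= h by rewrite divr_ge0// subr_ge0.
have step k : (k <= n.+1)%N -> `|Q (a + h *+ k) - Q a| <= C * h ^+ 2 *+ k.
  elim: k => [_|k ih kn]; first by rewrite !mulr0n addr0 subrr normr0.
  rewrite (_ : _ - _ = Q (a + h *+ k) - Q a +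
    (Q (a + h *+ k.+1) - Q (a + h *+ k))); last by ring.
  apply: le_trans (ler_normD _ _) _.
  rewrite [leRHS]mulrSr; apply: lerD; first by rewrite ih// ltnW.
  apply: le_trans (Qinc _ _ _ _ _) _.
  - by rewrite lerDl mulrn_wge0.
  - by rewrite lerD2l mulrSr lerDl.
  - rewrite -lerBrDl -mulr_natr /h mulrAC ler_pdivrMr// ler_wpM2l ?subr_ge0//.
    by rewrite ler_nat.
  - by rewrite (_ : a + _ - _ = h)//; rewrite mulrSr; ring.
have := step _ (leqnn _).
have n0 : n.+1%:R != 0 :> R by [].
rewrite -mulr_natr (_ : a + h * _ = b); last by rewrite /h; field.
move/le_trans; apply.
rewrite -mulr_natr (_ : C * h ^+ 2 * _ = A / n.+1%:R); last first.
  by rewrite /h /A; field.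
by rewrite ler_pdivrMr// mulrC -ler_pdivrMr// ltW.
Qed.

Lemma bounded_integrable_itv (a b K : R) (f : R -> R) (D : set R) :
  measurable D -> D `<=` `[a, b] -> measurable_fun D f ->
  (forall x, D x -> `|f x| <= K) ->
  mu.-integrable D (EFin \o f).
Proof.
move=> mD Dab mf fK; apply: measurable_bounded_integrable => //.
  apply: (@le_lt_trans _ _ (mu `[a, b])).
    by apply: le_measure; rewrite ?inE//; exact: measurable_itv.
  by rewrite /= lebesgue_measure_itv/=; case: ifPn => // _; rewrite -EFinB ltry.
exists K; split; first by rewrite num_real.
by move=> M KM x Dx; apply: le_trans (fK x Dx) _; exact: ltW.
Qed.

(** A chain rule for a bounded measurable [f], with no continuity: when [w] and
    the increments of [P] are controlled by the primitive of [f], both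
    [\int_[s, s'] f * w] and [P s - P s'] lie between [w s'] and [w s] times the
    integral [D] of [f], so that they differ by O((s' - s)^2). *)
Lemma integral_mul_decreasing_primitive (a b K L : R) (f w P : R -> R) : a <= b ->
  measurable_fun `[a, b] f -> measurable_fun `[a, b] w ->
  (forall s, a <= s <= b -> 0 <= f s <= K) ->
  (forall s, a <= s <= b -> 0 <= w s) -> 0 <= L ->
  (forall s s', a <= s -> s <= s' -> s' <= b ->
    let D := \int[mu]_(x in `]s, s']) f x in
    (w s' <= w s <= w s' + L * D) /\ (w s' * D <= P s - P s' <= w s * D)) ->
  (\int[mu]_(s in `[a, b]) (f s * w s)%:E = (P a - P b)%:E)%E.
Proof.
move=> ab mf mw fK w0 L0 hP.
have intS (h : R -> R) (M : R) (c d : bool) s s' : a <= s -> s' <= b ->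
    measurable_fun `[a, b] h -> (forall s, a <= s <= b -> 0 <= h s <= M) ->
    mu.-integrable [set` Interval (BSide c s) (BSide d s')] (EFin \o h).
  move=> as_ sb mh hM; apply: (@bounded_integrable_itv a b M) => //.
  - apply: subset_itvScc; rewrite bnd_simp //.
  - apply: measurable_funS mh => //; apply: subset_itvScc; rewrite bnd_simp//.
  - move=> x; have sub : [set` Interval (BSide c s) (BSide d s')] `<=` `[a, b].
      by apply: subset_itvScc; rewrite bnd_simp//.
    move=> /sub; rewrite /= in_itv/= => /hM/andP[h0 hx].
    by rewrite ger0_norm.
have fwK s : a <= s <= b -> 0 <= f s * w s <= K * w a.
  move=> /[dup] /andP[as_ sb] sab; have /andP[f0 fk] := fK s sab.
  have ws : w s <= w a by have [/andP[]] := hP a s (lexx a) as_ sb.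
  by rewrite mulr_ge0 ?w0//= ler_pM// w0.
have mfw : measurable_fun `[a, b] (fun s => f s * w s) by apply: measurable_funM.
pose Q s := \int[mu]_(x in `[a, s]) (f x * w x) + P s.
have Qab : Q b = Q a.
  apply: (@quadratic_increments_cst Q a b (L * K ^+ 2)) => // s s' as_ ss s'b.
  have := hP s s' as_ ss s'b => /=; set D := Rintegral _ _ _ => -[].
  move=> /andP[w1 w2] /andP[P1 P2].
  have sub x : `]s, s']%classic x -> a <= x <= b.
    by rewrite /= in_itv/= => /andP[sx xs]; rewrite (le_trans as_ (ltW sx)) (le_trans xs).
  have D0 : 0 <= D.
    by apply: Rintegral_ge0 => x /sub/fK/andP[].
  have DK : D <= K * (s' - s).
    rewrite /D; apply: (@le_trans _ _ (\int[mu]_(x in `]s, s']) K)).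
      apply: le_Rintegral => //.
      - exact: (intS _ K).
      - apply: (@bounded_integrable_itv a b `|K|) => //.
      - by move=> x /sub/fK/andP[].
    rewrite Rintegral_cst//= lebesgue_measure_itv/= lte_fin.
    case: ifPn => //; rewrite -leNgt => s's.
    by rewrite (@le_anti _ _ s s') ?ss//= subrr.
  have QE : Q s' - Q s = \int[mu]_(x in `]s, s']) (f x * w x) - (P s - P s').
    rewrite /Q -(@Rintegral_itvB _ _ (BLeft a) (BRight s') s)//; last first.
      exact: (intS _ (K * w a)).
    by ring.
  have I1 : w s' * D <= \int[mu]_(x in `]s, s']) (f x * w x).
    rewrite mulrC -RintegralZr//; last exact: (intS _ K).
    apply: le_Rintegral => //.
    - apply: (intS _ (K * w s')) => //; first exact: measurable_funM.
      move=> x /fK/andP[f0 fk]; rewrite mulr_ge0 ?w0 ?s'b ?(le_trans as_)//=.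
      by rewrite ler_wpM2r// w0// s'b (le_trans as_).
    - exact: (intS _ (K * w a)).
    - move=> x /[dup] /sub /[dup] xab /fK/andP[f0 _].
      rewrite /= in_itv/= => /andP[sx xs'].
      rewrite ler_wpM2l//; case/andP: xab => ax xb.
      by have [/andP[]] := hP x s' ax xs' s'b.
  have I2 : \int[mu]_(x in `]s, s']) (f x * w x) <= w s * D.
    rewrite mulrC -RintegralZr//; last exact: (intS _ K).
    apply: le_Rintegral => //.
    - exact: (intS _ (K * w a)).
    - apply: (intS _ (K * w s)) => //; first exact: measurable_funM.
      move=> x /fK/andP[f0 fk]; rewrite mulr_ge0 ?w0 ?as_ ?(le_trans ss)//=.
      by rewrite ler_wpM2r// w0// as_ (le_trans ss).
    - move=> x /[dup] /sub /[dup] xab /fK/andP[f0 _].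
      rewrite /= in_itv/= => /andP[sx xs'].
      rewrite ler_wpM2l//; case/andP: xab => ax xb.
      by have [/andP[]] := hP s x as_ (ltW sx) xb.
  apply: (@le_trans _ _ ((w s - w s') * D)).
    by rewrite QE ler_norml; apply/andP; split; lra.
  apply: (@le_trans _ _ (L * D ^+ 2)).
    by rewrite expr2 mulrA ler_wpM2r//; lra.
  rewrite -mulrA ler_wpM2l// -exprMn; apply: lerXn2r; rewrite // nnegrE//.
  exact: le_trans DK.
move: Qab; rewrite /Q [X in _ = X + _](_ : _ = 0); last first.
  by rewrite set_itv1 Rintegral_set1.
move=> Qab; rewrite -[LHS]fineK; last first.
  by apply: integrable_fin_num => //; exact: (intS _ (K * w a)).
by congr EFin; move: Qab; rewrite /Rintegral => Qab; lra.
Qed.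

Lemma measurable_running_integral (a b : R) (f : R -> R) : a <= b ->
  mu.-integrable `[a, b] (EFin \o f) ->
  measurable_fun `[a, b] (fun s => \int[mu]_(x in `[a, s]) f x).
Proof.
move=> ab intf; apply: subspace_continuous_measurable_fun => //.
exact: parameterized_integral_continuous.
Qed.

(** The case [w = P = expR (- F)], with [F] the primitive of [f]: the fraction
    lost at hazard rate [f] is the integral of the losses. *)
Lemma integral_hazard_expR (a b K : R) (f : R -> R) : a <= b ->
  measurable_fun `[a, b] f -> (forall s, a <= s <= b -> 0 <= f s <= K) ->
  (\int[mu]_(s in `[a, b]) (f s * expR (- \int[mu]_(x in `[a, s]) f x))%:E =
   (1 - expR (- \int[mu]_(x in `[a, b]) f x))%:E)%E.
Proof.
move=> ab mf fK; pose F s := \int[mu]_(x in `[a, s]) f x.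
have intf : mu.-integrable `[a, b] (EFin \o f).
  apply: (@bounded_integrable_itv a b K) => //.
  by move=> x; rewrite /= in_itv/= => /fK/andP[f0 fk]; rewrite ger0_norm.
have mF : measurable_fun `[a, b] F by exact: measurable_running_integral.
rewrite (@integral_mul_decreasing_primitive a b K 1 f
  (fun s => expR (- F s)) (fun s => expR (- F s)))//.
- by rewrite /F set_itv1 Rintegral_set1 oppr0 expR0.
- by apply: measurableT_comp => //; exact: measurableT_comp.
- move=> s s' as_ ss s'b; set D := Rintegral _ _ _ => /=.
  have DE : D = F s' - F s.
    rewrite /D /F (@Rintegral_itvB _ _ (BLeft a) (BRight s') s)//.
    apply: integrableS intf => //; apply: subset_itvScc; rewrite bnd_simp//.
  have D0 : 0 <= D.
    apply: Rintegral_ge0 => x; rewrite /= in_itv/= => /andP[sx xs].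
    by have /andP[] : 0 <= f x <= K by rewrite fK// (le_trans as_ (ltW sx)) (le_trans xs).
  have F0 : 0 <= F s.
    apply: Rintegral_ge0 => x; rewrite /= in_itv/= => /andP[sx xs].
    by have /andP[] : 0 <= f x <= K by rewrite fK// sx (le_trans xs)// (le_trans ss).
  have -> : F s' = F s + D by rewrite DE; ring.
  rewrite opprD expRD; set E := expR (- F s).
  have E0 : 0 <= E by exact: expR_ge0.
  have E1 : E <= 1 by rewrite /E -expR0 ler_expR; lra.
  have e0 : 0 <= expR (- D) by exact: expR_ge0.
  have e1 : expR (- D) <= 1 by rewrite -expR0 ler_expR; lra.
  have h1 : 1 - D <= expR (- D) by rewrite expR_ge1Dx.
  have h2 : expR (- D) * (1 + D) <= 1.
    rewrite expRN mulrC ler_pdivrMr ?expR_gt0// mul1r; exact: expR_ge1Dx.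
  by split; apply/andP; split; nra.
Qed.

(** The case [w = N], [P = N ^+ 2 / 2], where [N] decreases at rate [f]. *)
Lemma integral_mul_self_primitive (a b K : R) (f N : R -> R) : a <= b ->
  measurable_fun `[a, b] f -> measurable_fun `[a, b] N ->
  (forall s, a <= s <= b -> 0 <= f s <= K) ->
  (forall s, a <= s <= b -> 0 <= N s) ->
  (forall s s', a <= s -> s <= s' -> s' <= b ->
    N s - N s' = \int[mu]_(x in `]s, s']) f x) ->
  (\int[mu]_(s in `[a, b]) (f s * N s)%:E = ((N a ^+ 2 - N b ^+ 2) / 2)%:E)%E.
Proof.
move=> ab mf mN fK N0 NE.
rewrite (@integral_mul_decreasing_primitive a b K 1 f N (fun s => N s ^+ 2 / 2))//.
  by rewrite mulrBl.
move=> s s' as_ ss s'b; rewrite -NE//=.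
have D0 : 0 <= N s - N s'.
  rewrite NE//; apply: Rintegral_ge0 => x; rewrite /= in_itv/= => /andP[sx xs].
  by have /andP[] : 0 <= f x <= K by rewrite fK// (le_trans as_ (ltW sx)) (le_trans xs).
by split; apply/andP; split; nra.
Qed.

End lebesgue_integral_on_the_line.

(** * Number balance for a regular density *)

Section regular_density.
Context {R : realType}.
Local Notation mu := (@lebesgue_measure R).
Variables (k0 M : R) (gini : R -> R) (u : R -> R -> R).

Definition number t : R := fine (\int[mu]_x (u t x)%:E)%E.
Definition self_convolution t : R := fine (\int[mu]_x (u t x * u t (t - x))%:E)%E.
Definition birth_rate t : R := k0 / (2 * number t) * self_convolution t.
(** The density at creation. Being 0 for negative sizes, it is a function on the
    whole line, to which translation and reflection apply. *)
Definition birth_profile x : R :=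
  if x < 0 then 0 else if x < 1 then gini x else birth_rate x.
(** The rate at which a particle of size [x] merges at time [s]: all its mergers
    are with particles of size [s - x]. *)
Definition loss_rate x s : R := k0 * (u s (s - x) / number s).

Local Notation N := number.
Local Notation b := birth_rate.
Local Notation G := birth_profile.

(* Vanishing of [u] off the open region and on the line [x = 1] lets every
   integral run over the whole line. Continuity in time is stated along sequences
   at a fixed size, the form in which dominated convergence uses it. *)
Hypothesis k0_gt0 : 0 < k0.
Hypothesis gini_bnd : forall x : R, 0 <= x < 1 -> 0 <= gini x <= M.
Hypothesis gini_meas : measurable_fun (`[0%R, 1[%classic : set R) gini.
Hypothesis u_meas : measurable_fun setT (fun p : R * R => u p.1 p.2).
Hypothesis u_ge0 : forall t x, 0 <= u t x.
Hypothesis u_supp : forall t x : R, ~~ [&& 1 <= t, 0 < x, x < t & x != 1] -> u t x = 0.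
Hypothesis u_number : forall t, 1 <= t -> (0 < \int[mu]_x (u t x)%:E < +oo)%E.
Hypothesis u_conv : forall t, 1 <= t ->
  (\int[mu]_x (u t x * u t (t - x))%:E < +oo)%E.
Hypothesis u_mild : forall t x : R, 1 <= t -> 0 < x < t -> x != 1 ->
  (u t x)%:E = ((G x)%:E * expeR (- (k0%:E *
     \int[mu]_(s in `[Num.max 1%R x, t]) (u s (s - x) / N s)%:E)))%E.
Hypothesis u_cont : forall (w : nat -> R) (t x : R), (forall n, 1 <= w n) -> 1 <= t ->
  w n @[n --> \oo] --> t -> x != 1 -> x != t -> u (w n) x @[n --> \oo] --> u t x.

Lemma number_EFin t : 1 <= t -> (N t)%:E = (\int[mu]_x (u t x)%:E)%E.
Proof.
move=> t1; have /andP[N0 Ny] := u_number t1.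
by rewrite fineK// ge0_fin_numE// ltW.
Qed.

Lemma number_gt0 t : 1 <= t -> 0 < N t.
Proof.
by move=> t1; rewrite -lte_fin number_EFin//; have /andP[] := u_number t1.
Qed.

Lemma self_convolution_EFin t : 1 <= t ->
  (self_convolution t)%:E = (\int[mu]_x (u t x * u t (t - x))%:E)%E.
Proof.
move=> t1; rewrite fineK// ge0_fin_numE ?u_conv//.
by apply: integral_ge0 => x _; rewrite lee_fin mulr_ge0.
Qed.

Lemma self_convolution_ge0 t : 0 <= self_convolution t.
Proof.
by apply: fine_ge0; apply: integral_ge0 => x _; rewrite lee_fin mulr_ge0.
Qed.

Lemma number_ge0 t : 0 <= N t.
Proof. by apply: fine_ge0; apply: integral_ge0 => x _; rewrite lee_fin. Qed.

Lemma birth_rate_ge0 t : 0 <= b t.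
Proof.
by rewrite mulr_ge0 ?self_convolution_ge0// divr_ge0 ?mulr_ge0 ?number_ge0// ltW.
Qed.

Lemma birth_profile_ge0 x : 0 <= G x.
Proof.
rewrite /birth_profile; case: ltP => // x0; case: ltP => [x1|_].
  by have /andP[] : 0 <= gini x <= M by rewrite gini_bnd// x0.
exact: birth_rate_ge0.
Qed.

(** The survival factor is at most 1. *)
Lemma u_le_birth_profile t x : u t x <= G x.
Proof.
have [/and4P[t1 x0 xt x1]|/u_supp ->] := boolP [&& 1 <= t, 0 < x, x < t & x != 1];
  last exact: birth_profile_ge0.
rewrite -lee_fin (u_mild t1)// ?x0// -[leRHS]mule1.
apply: lee_wpmul2l; first by rewrite lee_fin birth_profile_ge0.
rewrite -expeR0 lee_expeR oppe_le0; apply: mule_ge0; first by rewrite lee_fin ltW.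
apply: integral_ge0 => s _.
by rewrite lee_fin divr_ge0// number_ge0.
Qed.

Lemma measurable_u_pair (d : measure_display) (T : measurableType d)
    (f h : T -> R) : measurable_fun setT f -> measurable_fun setT h ->
  measurable_fun setT (fun z => u (f z) (h z)).
Proof.
move=> mf mh; apply: (measurableT_comp u_meas (g := fun z => (f z, h z))).
exact: measurable_fun_pair.
Qed.

Lemma measurable_u t : measurable_fun setT (u t).
Proof. by apply: measurable_u_pair. Qed.

Lemma measurable_u_sub t : measurable_fun setT (fun x : R => u t (t - x)).
Proof.
by apply: measurable_u_pair => //; exact: measurable_funB.
Qed.

Lemma measurable_number : measurable_fun setT N.
Proof.
apply: measurableT_comp => //.
apply: (measurable_fun_fubini_tonelli_F (m2 := mu) (fun p : R * R => (u p.1 p.2)%:E)).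
- exact/measurable_EFinP.
- by move=> p; rewrite lee_fin.
Qed.

Lemma measurable_self_convolution : measurable_fun setT self_convolution.
Proof.
apply: measurableT_comp => //.
apply: (measurable_fun_fubini_tonelli_F (m2 := mu)
  (fun p : R * R => (u p.1 p.2 * u p.1 (p.1 - p.2))%:E)).
- apply/measurable_EFinP; apply: measurable_funM => //.
  by apply: measurable_u_pair => //; exact: measurable_funB.
- by move=> p; rewrite lee_fin mulr_ge0.
Qed.

Lemma measurable_number_inv : measurable_fun setT (fun t => (N t)^-1).
Proof.
rewrite (_ : (fun _ => _) = (fun t => N t `^ (-1))); last first.
  by apply/funext => t; rewrite powR_inv1// number_ge0.
exact: measurableT_comp (measurable_powR _) measurable_number.
Qed.

Lemma measurable_birth_rate : measurable_fun setT b.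
Proof.
apply: measurable_funM; last exact: measurable_self_convolution.
rewrite (_ : (fun _ => _) = (fun t => k0 / 2 * (N t)^-1)); last first.
  by apply/funext => t; rewrite invfM mulrA.
by apply: measurable_funM => //; exact: measurable_number_inv.
Qed.

Lemma measurable_birth_profile : measurable_fun setT G.
Proof.
apply: measurable_fun_if => //.
- exact: measurable_fun_ltr.
- rewrite setTI; apply: measurable_fun_if => //.
  + rewrite (_ : _ @^-1` _ = `[0, +oo[%classic)//.
    apply/seteqP; split => x /=; rewrite in_itv/= andbT; case: ltP => //.
  + by apply: measurable_fun_ltr => //; exact: measurable_funTS.
  + rewrite (_ : _ `&` _ = `[0, 1[%classic)//.
    apply/seteqP; split => x /=; rewrite in_itv/=; have [x0|x0] := ltP x 0 => //=.
      by case.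
    by case.
  + by apply: measurable_funTS; exact: measurable_birth_rate.
Qed.

Lemma measurable_loss_rate :
  measurable_fun setT (fun p : R * R => loss_rate p.1 p.2).
Proof.
apply: measurable_funM => //; apply: measurable_funM.
  by apply: measurable_u_pair => //; exact: measurable_funB.
exact: (measurableT_comp measurable_number_inv).
Qed.

Lemma loss_rate_ge0 x s : 0 <= loss_rate x s.
Proof. by rewrite mulr_ge0 ?divr_ge0 ?number_ge0// ltW. Qed.

(** If [G <= K] below [2 ^+ j], then for [x < 2 ^+ j.+1] one of [y], [x - y] is
    below [2 ^+ j], hence [u x y * u x (x - y) <= K * (u x y + u x (x - y))]. The
    right-hand side has integral [2 * K * N x], and [N x] cancels in the birth
    rate: [b x <= k0 * K]. *)
Lemma birth_profile_locally_bounded T :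
  exists2 K, 0 <= K & forall x, x <= T -> G x <= K.
Proof.
suff H j : exists2 K, 0 <= K & forall x, x < 2 ^+ j -> G x <= K.
  have [K K0 hK] := H (Num.truncn T).+1.
  exists K => // x xT; apply: hK; apply: (le_lt_trans xT).
  apply: (lt_le_trans (truncnS_gt T)).
  by rewrite -natrX ler_nat ltnW// ltn_expl.
elim: j => [|j [K K0 ih]].
  have /andP[g0 gM] : 0 <= gini 0 <= M by apply: gini_bnd; rewrite lexx ltr01.
  have M0 : 0 <= M := le_trans g0 gM.
  exists M => // x; rewrite expr0 => x1; rewrite /birth_profile x1.
  case: ltP => x0 //.
  by have /andP[] : 0 <= gini x <= M by rewrite gini_bnd ?x0.
exists (Num.max K (k0 * K)); first by rewrite le_max K0.
move=> x xj; case: (ltP x 1) => x1.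
  by rewrite le_max ih// (lt_le_trans x1)// exprn_ege1// ler1n.
rewrite le_max; apply/orP; right.
rewrite /birth_profile ltNge (le_trans ler01 x1)/= ltNge x1/=.
have N0 := number_gt0 x1.
have hconv : self_convolution x <= 2 * K * N x.
  rewrite -lee_fin self_convolution_EFin//.
  apply: (@le_trans _ _ (\int[mu]_y (K * u x y + K * u x (x - y))%:E)%E).
    apply: ge0_le_integral => //.
    - by move=> y _; rewrite lee_fin mulr_ge0.
    - apply/measurable_EFinP; apply: measurable_funM; first exact: measurable_u.
      exact: measurable_u_sub.
    - apply/measurable_EFinP; apply: measurable_funD; apply: measurable_funM => //.
        exact: measurable_u.
      exact: measurable_u_sub.
    - move=> y _; rewrite lee_fin.
      (* The factor whose size is below 2 ^+ j is the one replaced by K. *)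
      have [yj|yj] := ltP y (2 ^+ j).
        have : u x y <= K by apply: le_trans (u_le_birth_profile _ _) (ih _ yj).
        have := u_ge0 x y; have := u_ge0 x (x - y); nra.
      have : u x (x - y) <= K.
        apply: le_trans (u_le_birth_profile _ _) (ih _ _).
        by move: xj; rewrite exprS; lra.
      have := u_ge0 x y; have := u_ge0 x (x - y); nra.
  under eq_integral do rewrite EFinD !EFinM.
  have mu1 : measurable_fun setT (fun y : R => (u x y)%:E).
    by apply/measurable_EFinP; exact: measurable_u.
  have mu2 : measurable_fun setT (fun y : R => (u x (x - y))%:E).
    by apply/measurable_EFinP; exact: measurable_u_sub.
  rewrite ge0_integralD//; first last.
  - exact: measurable_funeM.
  - by move=> y _; rewrite mule_ge0// lee_fin.
  - exact: measurable_funeM.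
  - by move=> y _; rewrite mule_ge0// lee_fin.
  rewrite !ge0_integralZl_EFin//; try by move=> y _; rewrite lee_fin.
  rewrite (@ge0_integral_reflect _ (fun y => (u x y)%:E))//; last first.
    by move=> y; rewrite lee_fin.
  rewrite -number_EFin// -!EFinM -EFinD lee_fin; lra.
rewrite /birth_rate (le_trans (ler_wpM2l _ hconv))//.
  by rewrite divr_ge0 ?mulr_ge0// ltW.
by rewrite le_eqVlt; apply/orP; left; apply/eqP; field; rewrite gt_eqF.
Qed.


Lemma integral_u_itv t T : t <= T ->
  (\int[mu]_x (u t x)%:E = \int[mu]_(x in `[0%R, T]) (u t x)%:E)%E.
Proof.
move=> tT; rewrite [RHS]integral_mkcond; apply: eq_integral => x _.
rewrite patchE; case: ifPn => //; rewrite notin_setE /= in_itv/= => xT.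
rewrite u_supp//; apply/negP => /and4P[_ x0 xt _]; apply: xT.
by rewrite ltW//= (le_trans (ltW xt)).
Qed.

Lemma u_locally_bounded T : exists2 K, 0 <= K & forall t x, t <= T -> u t x <= K.
Proof.
have [K K0 hK] := birth_profile_locally_bounded T; exists K => // s x sT.
have [xs|sx] := ltP x s.
  by apply: le_trans (u_le_birth_profile _ _) (hK _ _); rewrite (le_trans (ltW xs)).
by rewrite u_supp//; apply/negP => /and4P[_ _ + _]; rewrite ltNge sx.
Qed.

(** Truncating the time at 1 makes continuity on the half-line a statement about
    a function on the whole line. It follows by dominated convergence from the
    local bound on [u]. *)
Lemma continuous_number : continuous (fun t : R => N (Num.max 1 t)).
Proof.
move=> t; apply/(@cvg_nbhsP _ R^o) => w wt.
pose v n := Num.max 1 (w n); set a := Num.max 1 t.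
have va : v n @[n --> \oo] --> a.
  have maxc : {for t, continuous (Num.max 1 : R -> R)}.
    by apply: continuous_max; [exact: cvg_cst|exact: cvg_id].
  exact: (@cvg_nbhsP _ R^o _ _ _).1 maxc _ wt.
have v1 n : 1 <= v n by rewrite le_max lexx.
have a1 : 1 <= a by rewrite le_max lexx.
have [T0 vT0] : exists T, forall n, v n <= T.
  have /cvg_seq_bounded/pinfty_ex_gt0[T T0 vT] : cvgn v by apply/cvg_ex; exists a.
  by exists T => n; apply: le_trans (vT n I); exact: ler_norm.
pose T := Num.max a T0.
have aT : a <= T by rewrite le_max lexx.
have vT n : v n <= T by rewrite le_max vT0 orbT.
have [K K0 uK] := u_locally_bounded T.
have mu_ s : measurable_fun `[0, T] (fun x => (u s x)%:E).
  by apply/measurable_EFinP; apply: measurable_funTS; exact: measurable_u.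
have cvae : {ae mu, forall x, `[0, T]%classic x ->
    (u (v n) x)%:E @[n --> \oo] --> (u a x)%:E}.
  exists [set 1; a]; split.
  - by apply: measurableU.
  - apply: countable_lebesgue_measure0; apply: finite_set_countable.
    exact: finite_set2.
  - move=> x /= nc; apply: contrapT => /not_orP[/eqP x1 /eqP xa]; apply: nc => _.
    by apply: cvg_EFin; [exact: nearW|exact: u_cont].
have intK : mu.-integrable `[0, T] (EFin \o cst K).
  apply: (@bounded_integrable_itv _ 0 T K (cst K)) => // x _.
  by rewrite ger0_norm.
have uKae : {ae mu, forall x n, `[0, T]%classic x -> (`|(u (v n) x)%:E| <= K%:E)%E}.
  by apply: aeW => x n _ /=; rewrite lee_fin ger0_norm// uK.
have [_ _ cv] := @dominated_convergence _ (measurableTypeR R) R mu `[0, T]%classic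
  (measurable_itv _) _ _ _ (fun n => mu_ (v n)) (mu_ a) cvae intK uKae.
suff: (N (v n))%:E @[n --> \oo] --> (N a)%:E by move/fine_cvg.
rewrite number_EFin// (@integral_u_itv _ T)//.
apply: cvg_trans cv; apply: near_eq_cvg; apply: nearW => n.
by rewrite number_EFin// (@integral_u_itv _ T).
Qed.

Lemma number_lower_bound T : 1 <= T ->
  exists2 c, 0 < c & forall t, 1 <= t <= T -> c <= N t.
Proof.
move=> T1; have [c cT hc] := EVT_min T1
  (continuous_subspaceT continuous_number : {within `[1, T], continuous _}).
exists (N (Num.max 1 c)); first by rewrite number_gt0// le_max lexx.
move=> t /[dup] t1T /andP[t1 _]; have := hc t; rewrite in_itv/= t1T => /(_ isT).
by rewrite (max_idPr t1).
Qed.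

Lemma loss_rate_locally_bounded T : 1 <= T ->
  exists K, forall x s, 1 <= s <= T -> 0 <= loss_rate x s <= K.
Proof.
move=> T1; have [c c0 hc] := number_lower_bound T1.
have [K K0 hK] := u_locally_bounded T.
exists (k0 * (K / c)) => x s /[dup] sT /andP[s1 sT'].
rewrite loss_rate_ge0/= /loss_rate; apply: ler_wpM2l; first exact: ltW.
apply: ler_pM => //; first by rewrite invr_ge0 number_ge0.
  exact: hK.
by rewrite lef_pV2 ?posrE ?number_gt0// hc.
Qed.


Lemma measurable_loss_rate_size x (D : set R) : measurable_fun D (loss_rate x).
Proof.
apply: measurable_funTS; apply: measurable_funM => //; apply: measurable_funM.
  by apply: measurable_u_pair => //; exact: measurable_funB.
exact: measurable_number_inv.
Qed.

Lemma u_mild_real t x : 1 <= t -> 0 < x < t -> x != 1 ->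
  u t x = G x * expR (- \int[mu]_(s in `[Num.max 1 x, t]) loss_rate x s).
Proof.
move=> t1 /[dup] x0t /andP[x0 xt] x1; apply: EFin_inj.
have [K hK] := loss_rate_locally_bounded t1.
rewrite (u_mild t1)// EFinM; congr (_ * _)%E.
have sub s : `[Num.max 1 x, t]%classic s -> 1 <= s <= t.
  by rewrite /= in_itv/= ge_max => /andP[/andP[-> _] ->].
rewrite -ge0_integralZl_EFin//; first last.
- by rewrite ltW.
- apply/measurable_EFinP; apply: measurable_funM; apply: measurable_funTS.
    by apply: measurable_u_pair => //; exact: measurable_funB.
  exact: measurable_number_inv.
- by move=> s _; rewrite lee_fin divr_ge0 ?number_ge0.
have -> : (\int[mu]_(s in `[Num.max 1%R x, t]) (k0%:E * (u s (s - x) / N s)%:E))%E =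
    (\int[mu]_(s in `[Num.max 1 x, t]) loss_rate x s)%:E.
  rewrite /Rintegral fineK; first by apply: eq_integral => s _; rewrite -EFinM.
  apply: integrable_fin_num => //; apply: (@bounded_integrable_itv _ 1 t K) => //.
  - exact: measurable_loss_rate_size.
  - by move=> s /sub/(hK x)/andP[l0 lK]; rewrite ger0_norm.
by rewrite -EFinN.
Qed.

(** Particles created at size [x] either still exist at time [t] or have been
    lost. The formula for [u s x] may fail at the single time [s = x], where [u]
    vanishes by convention. *)
Lemma birth_profile_loss t x : 1 <= t -> 0 < x < t -> x != 1 ->
  (G x)%:E = ((u t x)%:E + \int[mu]_(s in `[1%R, t]) (loss_rate x s * u s x)%:E)%E.
Proof.
move=> t1 /[dup] x0t /andP[x0 xt] x1; set a := Num.max 1 x.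
have [K hK] := loss_rate_locally_bounded t1.
have at_ : a <= t by rewrite ge_max t1 ltW.
have sub s : a <= s <= t -> 1 <= s <= t.
  by rewrite ge_max => /andP[/andP[-> _] ->].
pose E s := expR (- \int[mu]_(r in `[a, s]) loss_rate x r).
have intl : mu.-integrable `[a, t] (EFin \o loss_rate x).
  apply: (@bounded_integrable_itv _ a t K) => //; first exact: measurable_loss_rate_size.
  by move=> s; rewrite /= in_itv/= => /sub/(hK x)/andP[l0 lK]; rewrite ger0_norm.
have mlE : measurable_fun `[a, t] (fun s => (loss_rate x s * E s)%:E).
  apply/measurable_EFinP; apply: measurable_funM; first exact: measurable_loss_rate_size.
  apply: measurableT_comp => //; apply: measurableT_comp => //.
  exact: measurable_running_integral.
have mlu : measurable_fun setT (fun s => loss_rate x s * u s x).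
  apply: measurable_funM; first exact: measurable_loss_rate_size.
  exact: measurable_u_pair.
have -> : (\int[mu]_(s in `[1%R, t]) (loss_rate x s * u s x)%:E =
    \int[mu]_(s in `[a, t]) (loss_rate x s * u s x)%:E)%E.
  rewrite integral_mkcond [RHS]integral_mkcond; apply: eq_integral => s _.
  rewrite !patchE !mem_setE !in_itv/= ge_max.
  case: (leP 1 s) => //= s1; case: (leP x s) => //= sx.
  case: ifP => // _; rewrite (@u_supp s x) ?mulr0//.
  by apply/negP => /and4P[_ _ + _]; rewrite ltNge ltW.
have [_ <-] : measurable_fun `[a, t] (fun s => (loss_rate x s * u s x)%:E) /\
  (\int[mu]_(s in `[a, t]) ((G x)%:E * (loss_rate x s * E s)%:E) =
   \int[mu]_(s in `[a, t]) (loss_rate x s * u s x)%:E)%E.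
  apply: (@eq_integral_off_seq _ [:: x]) => //.
    exact: measurable_funeM.
  move=> s; rewrite /= in_itv/= inE => /andP[as_ st] sx.
  have s1 : 1 <= s by have /andP[] := sub s (introT andP (conj as_ st)).
  have xs : x < s.
    by rewrite lt_neqAle eq_sym sx (le_trans _ as_)// le_max lexx orbT.
  by rewrite (u_mild_real s1 _ x1) ?x0//= -EFinM mulrCA.
rewrite ge0_integralZl_EFin ?birth_profile_ge0//; last first.
  by move=> s _; rewrite lee_fin mulr_ge0 ?expR_ge0 ?loss_rate_ge0.
rewrite (@integral_hazard_expR _ a t K)//; last 2 first.
- exact: measurable_loss_rate_size.
- by move=> s st; apply: hK; exact: sub.
by rewrite (u_mild_real t1)// -EFinM -EFinD; congr EFin; rewrite -/a; ring.
Qed.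
Lemma self_convolution_birth_rate s : 1 <= s ->
  self_convolution s * (k0 / N s) = 2 * b s.
Proof. by move=> /number_gt0 N0; rewrite /birth_rate; field; rewrite gt_eqF. Qed.

(** The indicator of the time interval makes this a function on the whole plane,
    as Tonelli's theorem is applied on the plane. *)
Definition loss_density t (p : R * R) : \bar R :=
  (\1_(`[1, t]%classic : set R) p.2 * (loss_rate p.1 p.2 * u p.2 p.1))%:E.

Lemma measurable_loss_density t : measurable_fun setT (loss_density t).
Proof.
apply/measurable_EFinP; apply: measurable_funM.
  by apply: measurableT_comp => //; exact: measurable_indic.
apply: measurable_funM; first exact: measurable_loss_rate.
exact: measurable_u_pair.
Qed.

Lemma loss_density_ge0 t p : (0 <= loss_density t p)%E.
Proof. by rewrite lee_fin mulr_ge0// mulr_ge0 ?loss_rate_ge0. Qed.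

Lemma integral_loss_density t x :
  (\int[mu]_(s in `[1%R, t]) (loss_rate x s * u s x)%:E =
   \int[mu]_s loss_density t (x, s))%E.
Proof.
rewrite integral_mkcond; apply: eq_integral => s _.
rewrite patchE /loss_density/= indicE.
by case: ifP => _; rewrite ?mul1r ?mul0r.
Qed.

(** Exchanging the integrals leaves, at each time [s], the self-convolution of
    [u s] at [s] times [k0 / N s]; that is [2 * b s], as each merger removes two
    particles. *)
Lemma integral_total_loss t : 1 <= t ->
  (\int[mu]_(x in `[0%R, t]) \int[mu]_s loss_density t (x, s) =
   \int[mu]_(s in `[1%R, t]) (2 * b s)%:E)%E.
Proof.
move=> t1; transitivity (\int[mu]_x \int[mu]_s loss_density t (x, s))%E.
  rewrite integral_mkcond; apply: eq_integral => x _; rewrite patchE.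
  case: ifPn => //; rewrite notin_setE /= in_itv/= => xt; apply/esym.
  rewrite (_ : (fun s => _) = cst 0%E) ?integral0//.
  apply/funext => s; rewrite /loss_density/= indicE.
  case: (boolP (s \in _)); rewrite ?mul0r//.
  rewrite mem_setE in_itv/= => /andP[s1 st]; rewrite (@u_supp s x) ?mulr0//.
  apply/negP => /and4P[_ x0 xs _]; apply: xt.
  by rewrite ltW//= (le_trans (ltW xs)).
rewrite (fubini_tonelli (m1 := mu) (m2 := mu) (loss_density t))//; last 2 first.
- exact: measurable_loss_density.
- exact: loss_density_ge0.
rewrite [RHS]integral_mkcond; apply: eq_integral => s _; rewrite patchE.
case: ifPn => [|sn].
  rewrite mem_setE in_itv/= => /[dup] st /andP[s1 _].
  transitivity (\int[mu]_x ((k0 / N s)%:E * (u s x * u s (s - x))%:E))%E.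
    apply: eq_integral => x _; rewrite /loss_density/= indicE mem_setE in_itv/= st mul1r.
    by rewrite -EFinM /loss_rate; congr EFin; ring.
  rewrite ge0_integralZl_EFin//; first last.
  - by rewrite divr_ge0 ?number_ge0// ltW.
  - apply/measurable_EFinP; apply: measurable_funM; first exact: measurable_u.
    exact: measurable_u_sub.
  - by move=> x _; rewrite lee_fin mulr_ge0.
  by rewrite -self_convolution_EFin// -EFinM -self_convolution_birth_rate// mulrC.
rewrite (_ : (fun x => _) = cst 0%E) ?integral0//.
by apply/funext => x; rewrite /loss_density/= indicE (negPf sn) mul0r.
Qed.

Lemma u_at_initial_time x : 0 < x < 1 -> u 1 x = G x.
Proof.
move=> /andP[x0 x1]; rewrite (u_mild_real (lexx 1)) ?x0 ?lt_eqF//.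
by rewrite (max_idPl (ltW x1)) set_itv1 Rintegral_set1 oppr0 expR0 mulr1.
Qed.

Lemma integral_birth_profile t : 1 <= t ->
  (\int[mu]_(x in `[0%R, t]) (G x)%:E =
   (N 1)%:E + \int[mu]_(x in `[1%R, t]) (b x)%:E)%E.
Proof.
move=> t1; have mG (D : set R) : measurable_fun D (fun x => (G x)%:E).
  by apply/measurable_EFinP; apply: measurable_funTS; exact: measurable_birth_profile.
rewrite (@itv_bndbnd_setU _ _ _ (BLeft 1)) ?bnd_simp//.
rewrite ge0_integral_setU//; first last.
- by apply/disj_setPS => y [/=]; rewrite 2!in_itv/= => /andP[_ y1] /andP[]; rewrite leNgt y1.
- by move=> x _; rewrite lee_fin birth_profile_ge0.
- exact: mG.
congr (_ + _)%E; last first.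
  apply: eq_integral => x; rewrite mem_setE in_itv/= => /andP[x1 _].
  by rewrite /birth_profile ltNge (le_trans ler01 x1)/= ltNge x1.
rewrite number_EFin// (@integral_u_itv 1 1)// integral_itv_bndo_bndc//.
have [] // := @eq_integral_off_seq _ [:: 0; 1] `[0, 1]%classic
  (fun x => (G x)%:E) (fun x => (u 1 x)%:E).
move=> x /=; rewrite in_itv/= !inE negb_or => /andP[x0 x1] /andP[x0' x1'].
by rewrite u_at_initial_time// !lt_neqAle eq_sym x0' x0 x1' x1.
Qed.

Lemma birth_rate_locally_bounded T : exists K, forall t, 1 <= t <= T -> 0 <= b t <= K.
Proof.
have [K _ hK] := birth_profile_locally_bounded T; exists K => t /andP[t1 tT].
rewrite birth_rate_ge0/=; have := hK t tT.
by rewrite /birth_profile ltNge (le_trans ler01 t1)/= ltNge t1.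
Qed.

Lemma integrable_birth_rate T : mu.-integrable `[1, T] (EFin \o b).
Proof.
have [K hK] := birth_rate_locally_bounded T.
apply: (@bounded_integrable_itv _ 1 T K) => //.
  by apply: measurable_funTS; exact: measurable_birth_rate.
by move=> x; rewrite /= in_itv/= => /hK/andP[b0 bK]; rewrite ger0_norm.
Qed.

Lemma integral_birth_rate_EFin t :
  (\int[mu]_(x in `[1%R, t]) (b x)%:E)%E = (\int[mu]_(x in `[1, t]) b x)%:E.
Proof.
rewrite /Rintegral fineK//; apply: integrable_fin_num => //.
exact: integrable_birth_rate.
Qed.

(** Births are survivors plus losses: [N 1 + I = N t + 2 * I] with [I] the
    integral of [b] over [1, t], and [I] is finite. *)
Lemma number_balance t : 1 <= t -> N 1 - N t = \int[mu]_(x in `[1, t]) b x.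
Proof.
move=> t1; have := integral_birth_profile t1.
have mb (D : set R) : measurable_fun D (fun x => (b x)%:E).
  by apply/measurable_EFinP; apply: measurable_funTS; exact: measurable_birth_rate.
have -> : (\int[mu]_(x in `[0%R, t]) (G x)%:E =
    (N t)%:E + \int[mu]_(s in `[1%R, t]) (2 * b s)%:E)%E.
  rewrite -integral_total_loss// number_EFin// (@integral_u_itv t t)//.
  rewrite -ge0_integralD//; first last.
  - apply: measurable_funTS.
    apply: (measurable_fun_fubini_tonelli_F (m2 := mu) (loss_density t)).
      exact: measurable_loss_density.
    exact: loss_density_ge0.
  - by move=> x _; apply: integral_ge0 => s _; exact: loss_density_ge0.
  - by apply/measurable_EFinP; apply: measurable_funTS; exact: measurable_u.
  - by move=> x _; rewrite lee_fin.
  have [] // := @eq_integral_off_seq _ [:: 0; 1; t] `[0, t]%classic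
    (fun x => (G x)%:E) (fun x => (u t x)%:E +
      \int[mu]_s loss_density t (x, s))%E.
    by apply/measurable_EFinP; apply: measurable_funTS; exact: measurable_birth_profile.
  move=> x /=; rewrite in_itv/= !inE !negb_or => /andP[x0 xt] /and3P[x0' x1 xt'].
  rewrite -integral_loss_density.
  by apply: birth_profile_loss; rewrite // !lt_neqAle eq_sym x0' x0 xt xt'.
under eq_integral do rewrite EFinM.
rewrite ge0_integralZl_EFin//; last 2 first.
- by move=> x _; rewrite lee_fin birth_rate_ge0.
- exact: mb.
have alg (p q i : R) : p + 2 * i = q + i -> q - p = i by move=> ?; lra.
by rewrite integral_birth_rate_EFin -EFinM -!EFinD => /eqP; rewrite eqe => /eqP; exact: alg.
Qed.

(** * The lower bound on the number of particles *)

Lemma number_balance_itv s t : 1 <= s -> s <= t ->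
  N s - N t = \int[mu]_(x in `]s, t]) b x.
Proof.
move=> s1 st; have t1 := le_trans s1 st.
rewrite -(@Rintegral_itvB _ _ (BLeft 1) (BRight t) s)//.
  by rewrite -!number_balance//; ring.
exact: integrable_birth_rate.
Qed.

Lemma number_nonincreasing t : 1 <= t -> N t <= N 1.
Proof.
move=> t1; rewrite -subr_ge0 number_balance//.
by apply: Rintegral_ge0 => x _; exact: birth_rate_ge0.
Qed.

Lemma integral_birth_number t : 1 <= t ->
  (\int[mu]_(s in `[1%R, t]) (b s * N s)%:E = ((N 1 ^+ 2 - N t ^+ 2) / 2)%:E)%E.
Proof.
move=> t1; have [K hK] := birth_rate_locally_bounded t.
apply: (@integral_mul_self_primitive _ 1 t K) => //.
- by apply: measurable_funTS; exact: measurable_birth_rate.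
- by apply: measurable_funTS; exact: measurable_number.
- by move=> s _; exact: number_ge0.
- by move=> s s' s1 ss' _; exact: number_balance_itv.
Qed.

Definition profile_upto t x : R := if 0 <= x <= t then G x else 0.

Lemma profile_upto_ge0 t x : 0 <= profile_upto t x.
Proof. by rewrite /profile_upto; case: ifP => // _; exact: birth_profile_ge0. Qed.

Lemma measurable_profile_upto t : measurable_fun setT (profile_upto t).
Proof.
have -> : profile_upto t = G \_ (`[0, t] : set R).
  by apply/funext => x; rewrite patchE mem_setE in_itv.
apply/(measurable_restrictT _ _).1 => //; apply: measurable_funTS.
exact: measurable_birth_profile.
Qed.

(** By the balance, the births up to time [t] number
    [N 1 + (N 1 - N t)]. *)
Lemma integral_profile_upto t : 1 <= t ->
  (\int[mu]_x (profile_upto t x)%:E = (2 * N 1 - N t)%:E)%E.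
Proof.
move=> t1; transitivity (\int[mu]_(x in `[0%R, t]) (G x)%:E)%E.
  rewrite [RHS]integral_mkcond; apply: eq_integral => x _.
  by rewrite patchE mem_setE in_itv/= /profile_upto; case: ifP.
have alg (p q : R) : p + (p - q) = 2 * p - q by ring.
by rewrite integral_birth_profile// integral_birth_rate_EFin -number_balance// -EFinD alg.
Qed.

Lemma self_convolution_le_profile t s : 1 <= s <= t ->
  ((self_convolution s)%:E <=
   \int[mu]_x (profile_upto t x * profile_upto t (s - x))%:E)%E.
Proof.
move=> /andP[s1 st]; rewrite self_convolution_EFin//.
have up x : u s x <= profile_upto t x.
  rewrite /profile_upto; case: ifPn => [_|xt]; first exact: u_le_birth_profile.
  rewrite u_supp//; apply: contra xt => /and4P[_ x0 xs _].
  by rewrite ltW//= (le_trans (ltW xs)).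
apply: ge0_le_integral_nomeas => // x _; rewrite lee_fin.
- by rewrite mulr_ge0.
- by rewrite mulr_ge0 ?profile_upto_ge0.
- by rewrite ler_pM.
Qed.

(** The integral over the plane of [(s, x) |-> H x * H (s - x)] is the square of
    the integral of [H], where [H] is the profile [G] cut off at [t]. *)
Lemma integral_birth_number_le t : 1 <= t ->
  (\int[mu]_(s in `[1%R, t]) (b s * N s)%:E <= (k0 / 2 * (2 * N 1 - N t) ^+ 2)%:E)%E.
Proof.
move=> t1; set H := profile_upto t.
have mH : measurable_fun setT H by exact: measurable_profile_upto.
have H0 x : 0 <= H x by exact: profile_upto_ge0.
have k2 : 0 <= k0 / 2 by rewrite divr_ge0// ltW.
pose conv2 (p : R * R) := (H p.2 * H (p.1 - p.2))%:E.
have mconv2 : measurable_fun setT conv2.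
  apply/measurable_EFinP; apply: measurable_funM.
    exact: measurableT_comp mH _.
  by apply: (measurableT_comp mH); exact: measurable_funB.
have conv20 p : (0 <= conv2 p)%E by rewrite lee_fin mulr_ge0.
have mEH : measurable_fun setT (EFin \o H) by exact/measurable_EFinP.
apply: (@le_trans _ _ (\int[mu]_s ((k0 / 2)%:E * \int[mu]_x conv2 (s, x)))%E).
  apply: ge0_le_integral_nomeas => //.
  - by move=> s _; rewrite lee_fin mulr_ge0 ?birth_rate_ge0 ?number_ge0.
  - by move=> s _; rewrite mule_ge0 ?lee_fin// integral_ge0.
  - move=> s; rewrite /= in_itv/= => st.
    have s1 : 1 <= s by case/andP: st.
    have -> : b s * N s = k0 / 2 * self_convolution s.
      by rewrite /birth_rate; field; rewrite gt_eqF// number_gt0.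
    by rewrite EFinM lee_wpmul2l ?lee_fin//; exact: self_convolution_le_profile.
rewrite ge0_integralZl_EFin//; first last.
- exact: (measurable_fun_fubini_tonelli_F (m2 := mu) conv2).
- by move=> s _; rewrite integral_ge0.
rewrite (fubini_tonelli (m1 := mu) (m2 := mu) conv2)//.
have -> : (\int[mu]_x \int[mu]_s conv2 (s, x) =
    \int[mu]_x ((2 * N 1 - N t)%:E * (H x)%:E))%E.
  apply: eq_integral => x _.
  under eq_integral do rewrite /conv2/= EFinM.
  rewrite ge0_integralZl_EFin//.
  - by rewrite (@ge0_integral_shift _ (EFin \o H))// integral_profile_upto// muleC.
  - by move=> s _; rewrite lee_fin.
  - by apply: (measurableT_comp mEH); exact: measurable_funB.
rewrite ge0_integralZl//; first last.
- by rewrite lee_fin; have := number_nonincreasing t1; have := number_ge0 1; lra.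
- by move=> x _; rewrite lee_fin.
by rewrite integral_profile_upto// -!EFinM expr2.
Qed.

(** The two estimates of the integral of [b * N] conflict at a time where [N] has
    dropped to exactly [N 1 / 2]; for smaller values of [N] they need not. The
    intermediate value theorem supplies such a time. *)
Lemma number_gt_half t : k0 < 1 / 3 -> 1 <= t -> N 1 / 2 < N t.
Proof.
move=> k3 t1; rewrite ltNge; apply/negP => Nt.
have N1 := number_gt0 (lexx 1).
have [s s1t Ns] : exists2 s, s \in `[1, t] & N (Num.max 1 s) = N 1 / 2.
  apply: IVT => //; first by apply: continuous_subspaceT; exact: continuous_number.
  rewrite maxxx (max_idPr t1) minC le_max ge_min; apply/andP; split.
    by rewrite Nt.
  by apply/orP; left; lra.
have s1 : 1 <= s by move: s1t; rewrite in_itv/= => /andP[].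
have := integral_birth_number_le s1; rewrite integral_birth_number// lee_fin.
move: Ns; rewrite (max_idPr s1) => ->.
(* With N s = N 1 / 2, the two estimates of the integral are 3 / 8 * N 1 ^+ 2 and
   9 / 8 * k0 * N 1 ^+ 2. *)
have : 0 < (1 / 3 - k0) * N 1 ^+ 2 by rewrite mulr_gt0 ?exprn_gt0// subr_gt0.
move: (N 1) => n; nra.
Qed.

(** * Bounded losses and positive births *)

(** Translation invariance turns the partners [s - x] met by size [x] into births
    before time [t]. *)
Lemma integral_profile_shift_le x t : 0 <= x -> 1 <= t ->
  (\int[mu]_(s in `[Num.max 1%R x, t]) (G (s - x))%:E <= (2 * N 1)%:E)%E.
Proof.
move=> x0 t1; apply: (@le_trans _ _ (\int[mu]_s (profile_upto t (s - x))%:E)%E).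
  apply: ge0_le_integral_nomeas => //.
  - by move=> s _; rewrite lee_fin birth_profile_ge0.
  - by move=> s _; rewrite lee_fin profile_upto_ge0.
  - move=> s; rewrite /= in_itv/= ge_max => /andP[/andP[s1 xs] st].
    by rewrite /profile_upto subr_ge0 xs/= lerBlDr (le_trans st) ?lerDl.
rewrite (@ge0_integral_shift _ (EFin \o profile_upto t)); last 2 first.
- by apply/measurable_EFinP; exact: measurable_profile_upto.
- by move=> s; rewrite lee_fin profile_upto_ge0.
by rewrite integral_profile_upto// lee_fin gerBl number_ge0.
Qed.

Lemma u_gt0 t x : 1 <= t -> 0 < x < t -> x != 1 -> 0 < G x -> 0 < u t x.
Proof. by move=> t1 xt x1 Gx; rewrite u_mild_real// mulr_gt0// expR_gt0. Qed.

(** Sizes in the interval (t - c, 1) and their complements in [t] are both below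
    [c], so the integrand is positive on a set of positive measure. The one
    exception [x = t - 1], whose complement 1 is off the regular part, is null. *)
Lemma self_convolution_gt0 t c : 1 <= t -> 1 <= c -> t - c < 1 -> 0 <= t - c ->
  (forall x, 0 <= x < c -> 0 < G x) -> 0 < self_convolution t.
Proof.
move=> t1 c1 tc1 tc0 Gpos; rewrite lt_neqAle self_convolution_ge0 andbT eq_sym.
apply/eqP => conv0; have := self_convolution_EFin t1; rewrite conv0.
move/esym => int0.
have muc : measurable_fun setT (fun x : R => (u t x * u t (t - x))%:E).
  apply/measurable_EFinP; apply: measurable_funM; first exact: measurable_u.
  exact: measurable_u_sub.
have : ae_eq mu setT (fun x : R => (u t x * u t (t - x))%:E) (cst 0%E).
  apply/(ae_eq_integral_abs mu measurableT muc); rewrite -[RHS]int0.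
  by apply: eq_integral => x _; rewrite gee0_abs// lee_fin mulr_ge0.
move=> [A [mA A0 hA]].
pose D : set R := `]t - c, 1[%classic.
have : (mu D <= mu (A `|` [set (t - 1)%R]))%E.
  apply: le_measure; rewrite ?inE.
  - exact: measurable_itv.
  - by apply: measurableU.
  move=> x; rewrite /D/= in_itv/= => /andP[xc x1].
  have [->|xt] := eqVneq x (t - 1); [by right|left; apply: hA => /= /(_ I) []].
  have x0 : 0 < x by exact: le_lt_trans xc.
  have xltt : x < t by exact: lt_le_trans t1.
  apply/eqP; rewrite mulf_eq0 !gt_eqF//; apply: u_gt0; rewrite ?subr_gt0 ?x0 ?gtrBl//.
  - by rewrite xltt.
  - by apply: contra xt => /eqP tx; apply/eqP; lra.
  - by apply: Gpos; lra.
  - by rewrite lt_eqF.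
  - by apply: Gpos; lra.
move/le_trans => /(_ _ (measureU2 _ mA (measurable_set1 _))).
rewrite [X in (X + _)%E]A0 [X in (_ + X)%E]lebesgue_measure_set1 adde0.
by rewrite /D /= lebesgue_measure_itv/= lte_fin tc1 -EFinB lee_fin leNgt subr_gt0 tc1.
Qed.

(** Induction on unit intervals of sizes, with [c = n.+1] at each step. *)
Lemma birth_profile_gt0 : (forall x, 0 <= x < 1 -> 0 < gini x) ->
  forall x, 0 <= x -> 0 < G x.
Proof.
move=> gini0.
have step n : forall x, 0 <= x < n.+1%:R -> 0 < G x.
  elim: n => [|n ih] x /andP[x0 xn].
    by rewrite /birth_profile (ltNge x 0) x0/= xn gini0// x0.
  have [xn'|nx] := ltP x n.+1%:R; first by apply: ih; rewrite x0.
  have x1 : 1 <= x by rewrite (le_trans _ nx)// ler1n.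
  rewrite /birth_profile (ltNge x 0) x0/= (ltNge x 1) x1/= /birth_rate.
  rewrite mulr_gt0 ?divr_gt0 ?mulr_gt0 ?number_gt0//.
  apply: (@self_convolution_gt0 x n.+1%:R) => //.
  - by rewrite ler1n.
  - by move: xn; rewrite [in X in X -> _]mulrSr => xn; rewrite ltrBlDl.
  - by rewrite subr_ge0.
by move=> x x0; apply: (step (Num.truncn x)); rewrite x0 truncnS_gt.
Qed.
End regular_density.

(** * The regular part of the global mild solution *)

Section global_solution.
Context {R : realType}.
Local Notation mu := (@lebesgue_measure R).
Variables (k0 : R) (gini : R -> R) (g : R -> R -> R).
Hypothesis k0_gt0 : 0 < k0.
Hypothesis gini_cont : {within `[0, 1], continuous gini}.
Hypothesis gini_gt0 : forall x : R, 0 <= x <= 1 -> 0 < gini x.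
Hypothesis g_sol : global_mild_solution k0 gini g.

Definition regular_point (t x : R) := [&& 1 <= t, 0 < x, x < t & x != 1].
Definition regular_part t x : R := if regular_point t x then g t x else 0.
Local Notation u := regular_part.
Local Notation N := (number u).
Local Notation G := (birth_profile k0 gini u).

Lemma mild_ge0 t x : 1 <= t -> 0 <= x -> 0 <= g t x.
Proof.
move=> t1 x0; have [xt|tx] := leP x t; last by rewrite (g_sol.2 _ _ t1 tx).
have T1 : 1 < t + 1 by rewrite ltr_pwDr.
have [h _ _ _ _] := g_sol.1 _ T1.
have tT : t <= t + 1 by rewrite lerDl.
by apply: h; split; rewrite /= in_itv/= ?t1 ?x0 ?tT// (le_trans xt tT).
Qed.

Lemma mild_at t : 1 <= t -> [/\ (0 < total_number g t < +oo)%E,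
  (birth k0 g t < +oo)%E,
  forall x : R, 0 <= x < 1 -> (g t x)%:E = ((gini x)%:E * survival k0 g 1 t x)%E &
  forall x : R, 1 <= x <= t -> (g t x)%:E = (birth k0 g x * survival k0 g x t x)%E].
Proof.
move=> t1; have T1 : 1 < t + 1 by rewrite ltr_pwDr.
have tT : t <= t + 1 by rewrite lerDl.
by have [_ _ _ _ h] := g_sol.1 _ T1; apply: h; rewrite t1 tT.
Qed.

(** The rectangle of the definition depends on the horizon; near (t, x) with
    horizon [t + 1] it fills the whole quadrant. *)
Lemma mild_continuous (t x : R) : 1 <= t -> 0 <= x -> x != 1 -> x < t ->
  g p.1 p.2 @[p --> within [set p : R * R | 1 <= p.1 /\ 0 <= p.2] (nbhs (t, x))] -->
  g t x.
Proof.
move=> t1 x0 x1 xt; have T1 : 1 < t + 1 by rewrite ltr_pwDr.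
have [_ _ _ h _] := g_sol.1 _ T1.
have tT : t <= t + 1 by rewrite lerDl.
have dtx : (`[1, t + 1]%classic `*` `[0, t + 1]%classic) (t, x).
  by split; rewrite /= in_itv/= ?t1 ?x0 ?tT// (le_trans (ltW xt) tT).
have := h _ _ dtx x1; rewrite lt_eqF// => /(_ isT); apply: cvg_trans.
apply: cvg_app => A hA.
have {}hA : \forall q \near (t, x),
    (`[1, t + 1]%classic `*` `[0, t + 1]%classic) q -> A q := hA.
have near12 : \forall q \near (t, x), q.1 < t + 1 /\ q.2 < t + 1.
  exists ([set y : R | y < t + 1], [set y : R | y < t + 1]); last by [].
  by split; apply: lt_nbhsl; rewrite ?(lt_le_trans xt tT)// ltrDl.
suff : \forall q \near (t, x), 1 <= q.1 /\ 0 <= q.2 -> A q by [].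
apply: filterS2 hA near12 => q hq [qT1 qT2] [q1 q2]; apply: hq.
by split; rewrite /= in_itv/= ?q1 ?q2 ltW.
Qed.

Lemma measurable_regular_point :
  measurable [set p : R * R | regular_point p.1 p.2].
Proof.
have mb : measurable_fun setT (fun p : R * R => regular_point p.1 p.2).
  apply: measurable_and; first exact: measurable_fun_ler.
  apply: measurable_and; first exact: measurable_fun_ltr.
  apply: measurable_and; first exact: measurable_fun_ltr.
  by apply: measurable_neg; exact: measurable_fun_eqr.
rewrite -[X in measurable X]setTI.
exact: (mb measurableT [set true]).
Qed.

Lemma measurable_regular_part : measurable_fun setT (fun p : R * R => u p.1 p.2).
Proof.
rewrite (_ : (fun p => _) =
    (fun p => g p.1 p.2) \_ [set p : R * R | regular_point p.1 p.2]); last first.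
  by apply/funext => p; rewrite patchE /regular_part mem_setE.
apply/(measurable_restrictT _ _).1; first exact: measurable_regular_point.
apply: (@within_continuous_measurable_prod R _ (fun p => g p.1 p.2)).
  exact: measurable_regular_point.
move=> [t x] /= /and4P[t1 x0 xt x1].
have := mild_continuous t1 (ltW x0) x1 xt; apply: cvg_trans; apply: cvg_app.
apply: within_subset => -[s y] /= /and4P[s1 y0 _ _].
by split => //=; exact: ltW.
Qed.

Lemma regular_part_ge0 t x : 0 <= u t x.
Proof.
by rewrite /regular_part; case: ifP => // /and4P[t1 x0 _ _]; rewrite mild_ge0// ltW.
Qed.

Lemma regular_part_supp t x : ~~ regular_point t x -> u t x = 0.
Proof. by rewrite /regular_part => /negPf ->. Qed.

Lemma regular_part_cont (w : nat -> R) (t x : R) : (forall n, 1 <= w n) -> 1 <= t ->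
  w n @[n --> \oo] --> t -> x != 1 -> x != t -> u (w n) x @[n --> \oo] --> u t x.
Proof.
move=> w1 t1 wt x1 xt; have [x0|x0] := leP x 0.
  have u0 s : u s x = 0.
    by rewrite regular_part_supp//; apply/negP => /and4P[_ + _ _]; rewrite ltNge x0.
  by rewrite u0; under eq_fun do rewrite u0; exact: cvg_cst.
have [tx|xt'|txE] := ltgtP t x; last by rewrite txE eqxx in xt.
- rewrite regular_part_supp; last by rewrite /regular_point (ltNge x t) (ltW tx) !andbF.
  apply: cvg_near_cst; near=> n; apply/eqP; rewrite regular_part_supp//.
  apply/negP => /and4P[_ _ + _]; apply/negP; rewrite -leNgt.
  by near: n; apply: (cvgr_le t).
- rewrite [X in _ --> X]/regular_part /regular_point t1 x0 xt' x1/=.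
  have wtx : (w n, x) @[n --> \oo] -->
      within [set p : R * R | 1 <= p.1 /\ 0 <= p.2] (nbhs (t, x)).
    move=> A hA; have {}hA : \forall q \near (t, x), 1 <= q.1 /\ 0 <= q.2 -> A q := hA.
    have wx : (w n, x) @[n --> \oo] --> (t, x).
      exact: (cvg_pair wt (cvg_cst x)).
    suff : \forall n \near \oo, A (w n, x) by [].
    have : \forall n \near \oo, 1 <= w n /\ 0 <= x -> A (w n, x) by exact: wx hA.
    by apply: filterS => n; apply; split => //; exact: ltW.
  have := cvg_comp _ _ wtx (mild_continuous t1 (ltW x0) x1 xt').
  apply: cvg_trans; apply: near_eq_cvg; near=> n => /=.
  rewrite /regular_part /regular_point w1 x0 x1/= andbT.
  suff -> : x < w n by [].
  by near: n; apply: (cvgr_gt t).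
Unshelve. all: by end_near. Qed.


Lemma regular_partE t x : 1 <= t -> 0 <= x <= t -> x \notin [:: 0; 1; t] ->
  u t x = g t x.
Proof.
rewrite !inE !negb_or => t1 /andP[x0 xt] /and3P[x0' x1 xt'].
by rewrite /regular_part /regular_point t1 x1 !lt_neqAle eq_sym x0' x0 xt' xt.
Qed.

Lemma measurable_regular_part_sec t : measurable_fun setT (u t).
Proof. by apply: (measurable_u_pair measurable_regular_part). Qed.

Lemma integral_regular_part t : 1 <= t ->
  total_number g t = (\int[mu]_x (u t x)%:E)%E.
Proof.
move=> t1; rewrite (@integral_u_itv _ _ regular_part_supp t t)// /total_number.
have [] // := @eq_integral_off_seq R [:: 0; 1; t] `[0, t]%classic
  (fun x => (u t x)%:E) (fun x => (g t x)%:E).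
  by apply/measurable_EFinP; apply: measurable_funTS; exact: measurable_regular_part_sec.
by move=> x; rewrite /= in_itv/= => xt xs; rewrite regular_partE.
Qed.

Lemma integral_regular_conv t : 1 <= t ->
  (\int[mu]_(x in `[0%R, t]) (g t x * g t (t - x))%:E =
   \int[mu]_x (u t x * u t (t - x))%:E)%E.
Proof.
move=> t1; transitivity (\int[mu]_(x in `[0%R, t]) (u t x * u t (t - x))%:E)%E; last first.
  rewrite integral_mkcond; apply: eq_integral => x _.
  rewrite patchE; case: ifPn => //; rewrite notin_setE /= in_itv/= => xt.
  rewrite regular_part_supp ?mul0r//; apply/negP => /and4P[_ x0 xt' _]; apply: xt.
  by rewrite !ltW.
have [] // := @eq_integral_off_seq R [:: 0; 1; t; t - 1] `[0, t]%classic
  (fun x => (u t x * u t (t - x))%:E) (fun x => (g t x * g t (t - x))%:E).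
  apply/measurable_EFinP; apply: measurable_funTS; apply: measurable_funM.
    exact: measurable_regular_part_sec.
  exact: (measurable_u_sub measurable_regular_part).
move=> x; rewrite /= in_itv/= !inE !negb_or => /[dup] xt /andP[x0 xt'] /and4P[n0 n1 nt nt1].
rewrite !regular_partE//; rewrite ?subr_ge0 ?xt' ?gerBl ?x0// !inE !negb_or ?n0 ?n1//.
apply/and3P; split.
- by rewrite subr_eq0 eq_sym.
- by apply: contra nt1 => /eqP h; apply/eqP; lra.
- by apply: contra n0 => /eqP h; apply/eqP; lra.
Qed.

Lemma regular_number_fin t : 1 <= t -> (0 < \int[mu]_x (u t x)%:E < +oo)%E.
Proof. by move=> t1; rewrite -integral_regular_part//; have [] := mild_at t1. Qed.

Lemma total_numberE t : 1 <= t -> total_number g t = (N t)%:E.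
Proof.
by move=> t1; rewrite (number_EFin regular_number_fin)// integral_regular_part.
Qed.

Lemma number_regular_gt0 t : 1 <= t -> 0 < N t.
Proof. exact: (number_gt0 regular_number_fin). Qed.

Lemma birth_coefE t : 1 <= t ->
  (k0%:E / (2%:E * total_number g t))%E = (k0 / (2 * N t))%:E.
Proof.
move=> t1; rewrite total_numberE// -EFinM inver gt_eqF ?EFinM//.
by rewrite mulr_gt0// number_regular_gt0.
Qed.

(** The birth rate is a positive multiple of this integral. *)
Lemma regular_conv_fin t : 1 <= t -> (\int[mu]_x (u t x * u t (t - x))%:E < +oo)%E.
Proof.
move=> t1; have [_ + _ _] := mild_at t1.
rewrite /birth birth_coefE// integral_regular_conv//.
have c0 : 0 < k0 / (2 * N t) by rewrite divr_gt0// mulr_gt0// number_regular_gt0.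
by case: (\int[mu]_x _)%E => [r _|//|//]; [exact: ltry|rewrite gt0_muley ?lte_fin].
Qed.

Lemma birthE t : 1 <= t -> birth k0 g t = (birth_rate k0 u t)%:E.
Proof.
move=> t1; rewrite /birth birth_coefE// integral_regular_conv//.
by rewrite -(self_convolution_EFin regular_part_ge0 regular_conv_fin)// -EFinM.
Qed.

(** Both clauses of the mild formula are one, with creation time
    [Num.max 1 x]. *)
Lemma mild_formula t x : 1 <= t -> 0 <= x <= t ->
  (g t x)%:E = ((G x)%:E * survival k0 g (Num.max 1%R x) t x)%E.
Proof.
move=> t1 /andP[x0 xt]; have [_ _ hlt hge] := mild_at t1.
rewrite /birth_profile (ltNge x 0) x0/=; case: ltP => x1.
  by rewrite hlt// x0.
by rewrite hge ?x1// birthE.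
Qed.

Lemma divide_total_number s r : 1 <= s ->
  (r%:E / total_number g s)%E = (r / N s)%:E.
Proof.
move=> s1; rewrite total_numberE// inver gt_eqF ?EFinM//.
exact: number_regular_gt0.
Qed.

(** The losses of [g] and of [u] differ only at the times [s = x] and
    [s = x + 1], where the partner has size 0 or 1. *)
Lemma regular_mild t x : 1 <= t -> 0 < x < t -> x != 1 ->
  (u t x)%:E = ((G x)%:E * expeR (- (k0%:E *
     \int[mu]_(s in `[Num.max 1%R x, t]) (u s (s - x) / N s)%:E)))%E.
Proof.
move=> t1 /andP[x0 xt] x1.
rewrite {1}/regular_part /regular_point t1 x0 xt x1/= mild_formula ?(ltW x0) ?(ltW xt)// /survival.
congr (_ * expeR (- (_ * _)))%E; apply/esym.
have [] // := @eq_integral_off_seq R [:: x; x + 1] `[Num.max 1 x, t]%classic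
  (fun s => (u s (s - x) / N s)%:E) (fun s => (g s (s - x))%:E / total_number g s)%E.
  apply/measurable_EFinP; apply: measurable_funTS; apply: measurable_funM.
    by apply: (measurable_u_pair measurable_regular_part) => //; exact: measurable_funB.
  exact: (measurable_number_inv measurable_regular_part regular_part_ge0).
move=> s; rewrite /= in_itv/= ge_max => /andP[/andP[s1 xs] st].
rewrite !inE negb_or => /andP[sx sx1].
rewrite divide_total_number// regular_partE//.
  by rewrite subr_ge0 xs gerBl ltW.
rewrite !inE !negb_or subr_eq0 sx/=; apply/andP; split.
- by apply: contra sx1 => /eqP h; apply/eqP; lra.
- by apply/eqP => h; move: x0; rewrite (_ : x = 0) ?ltxx//; lra.
Qed.

(** * The two conclusions *)

Lemma gini_bounded : exists M, forall x : R, 0 <= x < 1 -> 0 <= gini x <= M.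
Proof.
have [c _ hc] := EVT_max ler01 gini_cont; exists (gini c) => x /andP[x0 x1].
apply/andP; split; first by apply/ltW/gini_gt0; rewrite x0 ltW.
by apply: hc; rewrite in_itv/= x0 ltW.
Qed.

Lemma measurable_gini : measurable_fun (`[0%R, 1[%classic : set R) gini.
Proof.
have mg : measurable_fun (`[0%R, 1%R]%classic : set R) gini.
  exact: subspace_continuous_measurable_fun.
apply: measurable_funS mg => //.
by apply: subset_itvScc; rewrite bnd_simp.
Qed.

Lemma mild_number_gt_half t : k0 < 1 / 3 -> 1 <= t ->
  (total_number g 1 / 2%:E < total_number g t)%E.
Proof.
move=> k3 t1; have [M gM] := gini_bounded.
rewrite !total_numberE// inver gt_eqF// -EFinM lte_fin.
apply: (number_gt_half k0_gt0 gM measurable_gini measurable_regular_part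
  regular_part_ge0 regular_part_supp regular_number_fin regular_conv_fin regular_mild
  regular_part_cont) => //.
Qed.

Lemma regular_profile_ge0 x : 0 <= G x.
Proof.
have [M gM] := gini_bounded.
exact: (birth_profile_ge0 k0_gt0 gM regular_part_ge0).
Qed.

Lemma mild_le_profile t x : 1 <= t -> 0 <= x <= t -> g t x <= G x.
Proof.
move=> t1 xt; rewrite -lee_fin mild_formula// -[leRHS]mule1.
apply: lee_wpmul2l; first by rewrite lee_fin regular_profile_ge0.
rewrite -expeR0 lee_expeR oppe_le0; apply: mule_ge0; first by rewrite lee_fin ltW.
apply: integral_ge0 => s; rewrite /= in_itv/= ge_max => /andP[/andP[s1 xs] _].
rewrite divide_total_number// lee_fin divr_ge0 ?mild_ge0 ?subr_ge0//.
by rewrite ltW ?number_regular_gt0.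
Qed.

(** The partner of [x] at time [s] has density at most [G (s - x)], and the total
    number of births is at most [2 * N 1], whatever [t]. *)
Lemma cumulated_loss_le c0 x t : 0 < c0 ->
  (forall s : R, 1 <= s -> (c0%:E <= total_number g s)%E) -> 0 <= x ->
  (\int[mu]_(s in `[Num.max 1%R x, t]) ((g s (s - x))%:E / total_number g s) <=
   (2 * N 1 / c0)%:E)%E.
Proof.
move=> c00 hc x0; have [M gM] := gini_bounded.
have [t1|t1] := leP 1 t; last first.
  rewrite set_itv_ge ?integral_set0; last first.
    by rewrite bnd_simp -ltNge (lt_le_trans t1)// le_max lexx.
  by rewrite lee_fin divr_ge0 ?mulr_ge0 ?(ltW (number_regular_gt0 _))// ltW.
have G0 := regular_profile_ge0.
apply: (@le_trans _ _ (\int[mu]_(s in `[Num.max 1%R x, t]) ((c0^-1)%:E * (G (s - x))%:E))%E).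
  apply: ge0_le_integral_nomeas => //.
  - move=> s; rewrite /= in_itv/= ge_max => /andP[/andP[s1 xs] _].
    rewrite divide_total_number// lee_fin divr_ge0 ?mild_ge0 ?subr_ge0//.
    by rewrite ltW ?number_regular_gt0.
  - by move=> s _; rewrite mule_ge0// lee_fin ?G0// invr_ge0 ltW.
  - move=> s; rewrite /= in_itv/= ge_max => /andP[/andP[s1 xs] _].
    rewrite divide_total_number// -EFinM lee_fin mulrC.
    have gs0 : 0 <= g s (s - x) by rewrite mild_ge0// subr_ge0.
    have Ns := number_regular_gt0 s1.
    apply: ler_pM => //; first by rewrite invr_ge0 ltW.
      rewrite lef_pV2 ?posrE//.
      by have := hc s s1; rewrite total_numberE// lee_fin.
    by rewrite mild_le_profile// subr_ge0 xs gerBl.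
have mG : measurable_fun setT G.
  exact: (measurable_birth_profile k0 measurable_gini measurable_regular_part
    regular_part_ge0).
rewrite ge0_integralZl_EFin//; last 3 first.
- by move=> s _; rewrite lee_fin.
- apply/measurable_EFinP; apply: measurable_funTS.
  by apply: (measurableT_comp mG); exact: measurable_funB.
- by rewrite invr_ge0 ltW.
rewrite mulrC EFinM; apply: lee_wpmul2l; first by rewrite lee_fin invr_ge0 ltW.
apply: (integral_profile_shift_le k0_gt0 gM measurable_gini measurable_regular_part
  regular_part_ge0 regular_part_supp regular_number_fin regular_conv_fin regular_mild
  regular_part_cont) => //.
Qed.

(** From time [Num.max 1 x] on, [g t x] is [G x] times the exponential of minus a
    bounded nondecreasing function of [t]. *)
Lemma mild_limit_gt0 c0 x : 0 < c0 ->
  (forall s : R, 1 <= s -> (c0%:E <= total_number g s)%E) -> 0 <= x ->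
  cvg (g t x @[t --> +oo]) /\ 0 < lim (g t x @[t --> +oo]).
Proof.
move=> c00 hc x0; have [M gM] := gini_bounded.
pose J t := (\int[mu]_(s in `[Num.max 1%R x, t]) ((g s (s - x))%:E / total_number g s))%E.
have integrand0 s : Num.max 1 x <= s -> (0 <= (g s (s - x))%:E / total_number g s)%E.
  rewrite ge_max => /andP[s1 xs].
  rewrite divide_total_number// lee_fin divr_ge0 ?mild_ge0 ?subr_ge0//.
  by rewrite ltW ?number_regular_gt0.
have J0 t : (0 <= J t)%E.
  by apply: integral_ge0 => s; rewrite /= in_itv/= => /andP[xs _]; exact: integrand0.
have JC t : (J t <= (2 * N 1 / c0)%:E)%E by exact: cumulated_loss_le.
have Jfin t : J t \is a fin_num.
  by rewrite ge0_fin_numE// (le_lt_trans (JC t))// ltry.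
have Jnd : nondecreasing_fun (fine \o J).
  move=> t t' tt'; apply: fine_le => //; apply: ge0_le_integral_nomeas => //.
  - by move=> s; rewrite /= in_itv/= => /andP[xs _]; exact: integrand0.
  - by move=> s; rewrite /= in_itv/= => /andP[xs _]; exact: integrand0.
  - by apply: subset_itvl; rewrite bnd_simp.
have Jub : has_ubound (range (fine \o J)).
  by exists (2 * N 1 / c0) => _ [t _ <-]; rewrite /= -lee_fin fineK.
have /(_ Jnd Jub) Jcvg := @nondecreasing_cvgr R (fine \o J).
set L := sup _ in Jcvg.
have glim : g t x @[t --> +oo] --> G x * expR (- (k0 * L)).
  have : G x * expR (- (k0 * (fine \o J) t)) @[t --> +oo] --> G x * expR (- (k0 * L)).
    apply: cvgM; first exact: cvg_cst.
    apply: continuous_cvg; first exact: continuous_expR.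
    by apply: cvgN; apply: cvgM => //; exact: cvg_cst.
  apply: cvg_trans; apply: near_eq_cvg; near=> t.
  have t1 : 1 <= t by near: t; apply: nbhs_pinfty_ge; exact: num_real.
  have xt : x <= t by near: t; apply: nbhs_pinfty_ge; exact: num_real.
  apply: EFin_inj; rewrite mild_formula ?x0//.
  by rewrite EFinM; congr (_ * _)%E; rewrite /survival -/(J t) /= -[J t]fineK.
split; first by apply/cvg_ex; eexists; exact: glim.
rewrite (cvg_lim _ glim)//.
rewrite mulr_gt0 ?expR_gt0//.
apply: (birth_profile_gt0 k0_gt0 gM measurable_regular_part
  regular_part_ge0 regular_part_supp regular_number_fin regular_conv_fin regular_mild
  regular_part_cont) => //.
by move=> y /andP[y0 y1]; apply: gini_gt0; rewrite y0 ltW.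
Unshelve. all: by end_near. Qed.

End global_solution.

Theorem proposition6 (R : realType) (k0 : R) (gini : R -> R) (g : R -> R -> R)
    (k0_gt0 : 0 < k0)
    (gini_cont : {within `[0, 1], continuous gini})
    (gini_gt0 : forall x : R, 0 <= x <= 1 -> 0 < gini x)
    (gini_mass : (\int[@lebesgue_measure R]_(x in `[0%R, 1%R])
                    (x * gini x)%:E = 1)%E)
    (g_sol : global_mild_solution k0 gini g) :
  ((exists2 c0 : R, 0 < c0 & forall t : R, 1 <= t -> (c0%:E <= total_number g t)%E) ->
   forall x : R, 0 <= x ->
     cvg (g t x @[t --> +oo]) /\ 0 < lim (g t x @[t --> +oo]))
  /\
  (k0 < 1 / 3 ->
   forall t : R, 1 <= t -> (total_number g 1 / 2%:E < total_number g t)%E).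
Proof.
split=> [[c0 c00 hc] x x0|k3 t t1].
  exact: (mild_limit_gt0 k0_gt0 gini_cont gini_gt0 g_sol c00 hc x0).
exact: (mild_number_gt_half k0_gt0 gini_cont gini_gt0 g_sol k3 t1).
Qed.
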